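(* Let $0<\varepsilon<1$. Consider the online stochastic packing problem (defined in the context) in the random-order model, with $n$ agents, $m$ resources, and $q=\max_i |O_i|$, and let $\textsc{OPT}$ be the value of an optimal offline solution. Suppose that (1) $\max_{i,o} \frac{w_{io}}{\textsc{OPT}} \le \frac{\varepsilon}{(m+1)(\ln n+\ln q)}$, and (2) $\max_{i,o,j} \frac{a_{ioj}}{c_j} \le \frac{\varepsilon^3}{(m+1)(\ln n+\ln q)}$. Then, with high probability over the random arrival order, the Training-Based Primal-Dual algorithm is $(1-O(\varepsilon))$-competitive: it outputs a feasible allocation whose total value is at least $(1-O(\varepsilon))\,\textsc{OPT}$.
   Context: Online stochastic packing problem (PLP): there is a set $J$ of $m$ resources, resource $j$ having capacity $c_j>0$, known in advance. A set $I$ of $n$ agents arrives online one at a time; agent $i$ arrives with a finite set of mutually exclusive options $O_i$, where option $o\in O_i$ has value $w_{io}\ge 0$ and requires $a_{ioj}\ge 0$ units of each resource $j$. On arrival of agent $i$ the algorithm must irrevocably either pick one option of $O_i$ for it or pick none. An allocation is feasible if for each resource $j$ the total $\sum a_{ioj}$ over chosen pairs $(i,o)$ is at most $c_j$; its value is the sum of $w_{io}$ over chosen pairs. The goal is to maximize value. Random-order model: the set of agents (with their options) is arbitrary, but they arrive in a uniformly random order; the number $n$ of agents is known in advance. After normalizing so that all capacities equal $1$ (dividing $a_{ioj}$ by $c_j$), the primal LP is $\max \sum_i\sum_{o\in O_i} w_{io}x_{io}$ s.t. $\sum_{o\in O_i}x_{io}\le 1$ for all $i$, $\sum_{i,o}a_{ioj}x_{io}\le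 1$ for all $j$, $x\ge 0$; its dual is $\min \sum_j\beta_j+\sum_i z_i$ s.t. $z_i+\sum_j\beta_j a_{ioj}\ge w_{io}$ for all $i,o$, and $\beta,z\ge 0$. Training-Based Primal-Dual algorithm: (1) Let $S$ be the first $\varepsilon n$ agents to arrive; no option is selected for them. (2) Solve the dual LP restricted to the agents in $S$ and with objective $\sum_j \varepsilon\beta_j+\sum_{i\in S}z_i$ (the ''reduced instance'', i.e. capacities reduced to $\varepsilon$); let $\beta^*$ be the resulting optimal dual prices. (3) For each subsequent agent $i$, the gain of option $o\in O_i$ is $w_{io}-\sum_j\beta^*_j a_{ioj}$; if some option has nonnegative gain, select the option of maximum gain (ties are assumed not to occur). To guarantee feasibility, the algorithm is run with all capacities first decreased by a factor $1+O(\varepsilon)$.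
   Formalization: ''Ties do not occur'' is taken to include ties with picking no option: no agent after the sample has maximum gain exactly 0. Otherwise identical agents with one option each would all get gain 0, all be accepted, and violate the capacity. *)

(* Defs.v *)
From HB Require Import structures.
From mathcomp Require Import all_boot all_order all_fingroup all_algebra.
From mathcomp Require Import reals exp.

Set Implicit Arguments.
Unset Strict Implicit.
Unset Printing Implicit Defensive.

Import Order.TTheory GRing.Theory Num.Theory.

Local Open Scope ring_scope.

(* [Opt] is a common type of option labels; agent [i] may only be given labels
   from [opts i], and [value], [need] are irrelevant at other labels. *)
Record packing (R : realType) (n m : nat) (Opt : finType) := Packing {
  cap : 'I_m -> R;
  opts : 'I_n -> {set Opt};
  value : 'I_n -> Opt -> R;
  need : 'I_n -> Opt -> 'I_m -> R
}.

Section Packing.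
Variables (R : realType) (n m : nat) (Opt : finType).
Implicit Types (P : packing R n m Opt) (x : {ffun 'I_n -> option Opt}).
Implicit Types (i : 'I_n) (o : Opt) (j : 'I_m) (S : {set 'I_n}).
Implicit Types (beta : 'I_m -> R) (z : 'I_n -> R) (eps : R) (s : 'S_n).

Definition valid_packing P : Prop :=
  [/\ forall j, 0 < cap P j,
      forall i o, o \in opts P i -> 0 <= value P i o
    & forall i o j, o \in opts P i -> 0 <= need P i o j].

Definition max_options P : nat := \max_(i < n) #|opts P i|.

Definition usage P x j : R :=
  \sum_(i < n) (if x i is Some o then need P i o j else 0).

Definition total_value P x : R :=
  \sum_(i < n) (if x i is Some o then value P i o else 0).

(* [None] is the alternative of giving agent [i] no option. *)
Definition alternative P i (c : option Opt) : bool :=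
  if c is Some o then o \in opts P i else true.

Definition feasible P x : bool :=
  [forall i, alternative P i (x i)] && [forall j, usage P x j <= cap P j].

(* The empty allocation is feasible with value 0, so the default value 0 of
   the iterated maximum is harmless. *)
Definition OPT P : R := \big[Num.max/0]_(x | feasible P x) total_value P x.

Definition shrink_caps (k : R) P : packing R n m Opt :=
  Packing (fun j => cap P j / k) (opts P) (value P) (need P).

Definition norm_need P i o j : R := need P i o j / cap P j.

Definition gain P beta i o : R :=
  value P i o - \sum_(j < m) beta j * norm_need P i o j.

Definition dual_feasible P S beta z : Prop :=
  [/\ forall j, 0 <= beta j,
      forall i, i \in S -> 0 <= z i
    & forall i o, i \in S -> o \in opts P i ->
        value P i o <= z i + \sum_(j < m) beta j * norm_need P i o j].

Definition dual_objective eps S beta z : R :=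
  \sum_(j < m) eps * beta j + \sum_(i in S) z i.

Definition optimal_prices P eps S beta : Prop :=
  exists z, dual_feasible P S beta z /\
    forall beta' z', dual_feasible P S beta' z' ->
      dual_objective eps S beta z <= dual_objective eps S beta' z'.

(* [s t] is the agent arriving at time [t]; the sample consists of the first
   floor(eps * n) agents. *)
Definition sample eps s : {set 'I_n} :=
  [set s t | t : 'I_n & (t < Num.truncn (eps * n%:R))%N].

Definition best_option P beta i : option Opt :=
  [pick o in opts P i |
     (0 <= gain P beta i o)
     && [forall o' in opts P i, gain P beta i o' <= gain P beta i o]].

Definition training_based_alloc P S beta : {ffun 'I_n -> option Opt} :=
  [ffun i => if i \in S then None else best_option P beta i].

Definition alt_gain P beta i (c : option Opt) : R :=
  if c is Some o then gain P beta i o else 0.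

Definition max_gain P beta i (c : option Opt) : Prop :=
  alternative P i c /\
  forall c', alternative P i c' -> alt_gain P beta i c' <= alt_gain P beta i c.

(* Picking nothing counts as an alternative of gain 0. *)
Definition no_tie P beta i : Prop :=
  forall c c', max_gain P beta i c -> max_gain P beta i c' -> c = c'.

Definition order_prob (E : pred 'S_n) : R :=
  #|[set s | E s]|%:R / #|[set: 'S_n]|%:R.

End Packing.
Arguments order_prob R {n} E.

(* Main.v *)
(** For prices [beta], let the surplus of an agent be its largest gain; the dual
objective is then [eps * sum beta + sum of surpluses over the sample].

Moving one price of an optimal [beta] up or down shows that the sample uses at
most [eps] of each resource, and at least [eps] of each resource with a positive
price, up to the agents that are tied at [beta]. Those lie in the sample, so they
may be charged any fixed amount when the sample is compared with the remaining
agents. As a function of [beta], the sets of best alternatives of all agents take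
at most [(13 n q^2)^(m+1)] values, because they are determined by the signs of
[O(n q^2)] linear forms in [m+1] variables. For each value and each resource, a
Chernoff bound for sampling without replacement, in the form
[E exp (eta * b(S) - mu * b(~S)) <= 1], transfers the estimate from the sample [S]
to its complement with failure probability [(n q)^(-2(m+1))]. This gives
feasibility and shows that resources with a positive price are used up to a
fraction [1 - 10 eps] of the reduced capacity.

Hence the value obtained, which is the surplus outside of the sample plus the
price of the resources used there, is at least [(1 - 10 eps) D - Z], where
[D >= OPT / (1 + O(eps))] is the full dual value of [beta] and [Z] is the surplus
of the sample. Comparing [beta] with one fixed nearly optimal full dual solution
on the sample gives [Z = O(eps) D] by a single further Chernoff bound. *)

Require Import Defs.
From HB Require Import structures.
From mathcomp Require Import classical_sets sequences.
From mathcomp Require Import all_boot all_order all_fingroup all_algebra.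
From mathcomp Require Import reals exp.
From mathcomp Require Import ring lra zify.

Set Implicit Arguments.
Unset Strict Implicit.
Unset Printing Implicit Defensive.

Import Order.TTheory GRing.Theory Num.Theory.

Local Open Scope ring_scope.

(** * Sign patterns of finitely many linear forms *)

Lemma sgr_conic_comb (R : realFieldType) (a b u v : R) :
  0 < a -> 0 < b -> Num.sg u = Num.sg v -> Num.sg (a * u + b * v) = Num.sg u.
Proof.
move=> a0 b0; case: (sgrP u) => [->|u0|u0]; case: (sgrP v) => [->|v0|v0] //;
  try (move=> /eqP; rewrite ?(eq_sym 0) ?oner_eq0 ?oppr_eq0 ?oner_eq0 //).
- by rewrite !mulr0 addr0 sgr0.
- by move=> _; apply: gtr0_sg; rewrite addr_gt0 ?mulr_gt0.
- by rewrite -subr_eq0 opprK -mulr2n pnatr_eq0.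
- by rewrite eq_sym -subr_eq0 opprK -mulr2n pnatr_eq0.
- by move=> _; apply: ltr0_sg; rewrite -oppr_gt0 opprD addr_gt0 // -mulrN mulr_gt0 ?oppr_gt0.
Qed.

(* Induction on the number of forms: a sign pattern of the other forms on which
   [f] takes two different signs is, by convexity, already realised on the kernel
   of [f], whose dimension is smaller. *)
Lemma sign_pattern_cover (R : realFieldType) (N d : nat) (fs : seq 'cV[R]_d) :
  size fs = N ->
  exists B : seq 'rV[R]_d, (size B <= (3 * N).+1 ^ d)%N /\
    forall x : 'rV_d, exists2 y, y \in B &
      forall f, f \in fs -> Num.sg ((y *m f) 0 0) = Num.sg ((x *m f) 0 0).
Proof.
elim: N d fs => [|N IH] d fs.
  by case: fs => // _; exists [:: 0]; rewrite exp1n; split => // x; exists 0; rewrite ?inE.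
case: fs => // f fs [szfs].
have [B' [szB' HB']] := IH _ _ szfs.
have [f0|f0] := eqVneq f 0.
  exists B'; split.
    apply: leq_trans szB' _; elim: (d) => // e IHe.
    by rewrite !expnS leq_mul // ltnS leq_mul2l leqnSn orbT.
  move=> x; have [y yB Hy] := HB' x; exists y => // g; rewrite inE => /orP[/eqP->|/Hy//].
  by rewrite f0 !mulmx0.
pose M := row_base (kermx f).
have rk : (\rank (kermx f)).+1 = d.
  rewrite mxrank_ker; have -> : \rank f = 1%N.
    apply/eqP; rewrite eqn_leq rank_leq_col lt0n mxrank_eq0 f0 //.
  by rewrite subn1 prednK // lt0n; apply: contra_neq f0 => d0; subst d; apply/matrixP => -[].
have sz'' : size [seq M *m g | g <- fs] = N by rewrite size_map.
have [B'' [szB'' HB'']] := IH _ _ sz''.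
(* When no point has these signs, [rep] takes the default 0, which merely adds a harmless member to
   the list. *)
pose rep (u : 'rV[R]_(\rank (kermx f))) (s : R) := xget 0 [set w : 'rV[R]_d |
  (forall g, g \in fs -> Num.sg ((w *m g) 0 0) = Num.sg ((u *m M *m g) 0 0)) /\
  Num.sg ((w *m f) 0 0) = s]%classic.
exists (B' ++ flatten [seq [:: rep u 0; rep u 1; rep u (-1)] | u <- B'']); split.
  (* With [a = 3 N + 1], the recursion is [a^d + 3 a^(d-1) = (a + 3) a^(d-1) <= (a + 3)^d]. *)
  rewrite size_cat; have -> : size (flatten [seq [:: rep u 0; rep u 1; rep u (-1)] | u <- B'']) = (3 * size B'')%N.
    by elim: (B'') => [|u B IHB] //=; rewrite IHB mulnS.
  have -> : ((3 * N.+1).+1 = (3 * N).+1 + 3)%N by rewrite mulnS addnC addSn.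
  move: szB'; move: (size B') => b' szB'; rewrite -[in X in (_ <= X)%N]rk.
  have {}szB' : (b' <= (3 * N).+1 ^ (\rank (kermx f)).+1)%N by rewrite rk.
  apply: (@leq_trans (((3 * N).+1 + 3) * (3 * N).+1 ^ \rank (kermx f))).
    by rewrite mulnDl leq_add // ?leq_mul2l ?szB'' ?orbT // -expnS.
  rewrite [in X in (_ <= X)%N]expnS leq_mul2l /=.
  by elim: (\rank _) => // e IHe; rewrite !expnS leq_mul // leq_addr.
move=> x; have [y yB Hy] := HB' x.
have [sxy|sxy] := eqVneq (Num.sg ((y *m f) 0 0)) (Num.sg ((x *m f) 0 0)).
  exists y; first by rewrite mem_cat yB.
  by move=> g; rewrite inE => /orP[/eqP->|/Hy].
have [w w0 Hw] : exists2 w : 'rV_d, w *m f = 0 &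
    forall g, g \in fs -> Num.sg ((w *m g) 0 0) = Num.sg ((x *m g) 0 0).
  have mx0 (a : 'rV_d) : (a *m f) 0 0 = 0 -> a *m f = 0.
    by move=> H; apply/matrixP => i j; rewrite !ord1 H mxE.
  have [x0|x0] := eqVneq ((x *m f) 0 0) 0; first by exists x => //; exact: mx0.
  have [y0|y0] := eqVneq ((y *m f) 0 0) 0; first by exists y => //; exact: mx0.
  (* The values of [f] at [x] and [y] have opposite signs, so these weights cancel them; being
     positive, they keep the signs shared on [fs]. *)
  exists (`|(y *m f) 0 0| *: x + `|(x *m f) 0 0| *: y).
    apply: mx0; rewrite mulmxDl -!scalemxAl [LHS]mxE [X in X + _]mxE [X in _ + X]mxE.
    move: sxy; rewrite (normrEsg ((y *m f) 0 0)) (normrEsg ((x *m f) 0 0)).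
    set a := (y *m f) 0 0 in y0 *; set b := (x *m f) 0 0 in x0 *.
    move: y0 x0; case: (sgrP a) => [->|a0|a0] //; rewrite ?eqxx //;
    case: (sgrP b) => [->|b0|b0] //; rewrite ?eqxx // => _ _ _; ring.
  move=> g gfs; rewrite mulmxDl -!scalemxAl [X in Num.sg X]mxE [X in Num.sg (X + _)]mxE [X in Num.sg (_ + X)]mxE.
  by rewrite sgr_conic_comb ?normr_gt0 // Hy.
have /submxP[v wv] : (w <= M)%MS by rewrite eq_row_base; apply/sub_kermxP.
have [u uB Hu] := HB'' v.
pose s := Num.sg ((x *m f) 0 0).
have /xgetPex : (exists w, [set w : 'rV[R]_d |
  (forall g, g \in fs -> Num.sg ((w *m g) 0 0) = Num.sg ((u *m M *m g) 0 0)) /\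
  Num.sg ((w *m f) 0 0) = s]%classic w).
  exists x; split => // g gfs.
  rewrite -Hw // wv -[v *m M *m g]mulmxA -[u *m M *m g]mulmxA Hu //; exact: map_f.
move=> /(_ 0) -[H1 H2]; exists (rep u s).
  rewrite mem_cat; apply/orP; right; apply/flattenP.
  exists [:: rep u 0; rep u 1; rep u (-1)]; first exact: (map_f _ uB).
  by rewrite !inE /s; case: sgrP => _; rewrite eqxx ?orbT.
move=> g; rewrite inE => /orP[/eqP->//|gfs].
rewrite H1 // -Hw // wv -[u *m M *m g]mulmxA -[v *m M *m g]mulmxA Hu //; exact: map_f.
Qed.

(** * Chernoff bound for sampling without replacement *)

Section RandomSubset.
Variables (R : realType) (T : finType).
Implicit Types (A K : {set T}) (s : {perm T}) (u b : T -> R).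

Definition perms_covering K A := [set s : {perm T} | A \subset s @: K].

(** Composition with the transposition of [x] and [y], which fixes [A] pointwise, injects one set of
    permutations into the other. *)
Lemma card_perms_covering_sym K A x y : x \notin A -> y \notin A ->
  (#|perms_covering K (x |: A)| <= #|perms_covering K (y |: A)|)%N.
Proof.
move=> xA yA; rewrite -(card_imset (perms_covering K (x |: A)) (mulIg (tperm x y))).
apply/subset_leq_card/subsetP => _ /imsetP[s + ->]; rewrite !inE => /subsetP sA.
apply/subsetP => z; rewrite in_setU1 => zyA.
have /sA/imsetP[t tK tz] : tperm x y z \in x |: A.
  case/orP: zyA => [/eqP->|zA]; first by rewrite tpermR setU11.
  rewrite tpermD ?in_setU1 ?zA ?orbT //; first by apply: contraNneq xA => ->.
  by apply: contraNneq yA => ->.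
apply/imsetP; exists t => //; by rewrite permM -tz tpermK.
Qed.

(* Double counting: summed over all [x] outside [A], the permutations covering
   [x |: A] are counted [#|K| - #|A|] times for each one covering [A]. *)
Lemma card_perms_coveringU1 K A x : x \notin A ->
  (#|T| * #|perms_covering K (x |: A)| <= #|K| * #|perms_covering K A|)%N.
Proof.
move=> xA.
have AT : (0 < #|~: A|)%N by rewrite card_gt0; apply/set0Pn; exists x; rewrite inE.
have cT := cardsC A.
have E : (#|~: A| * #|perms_covering K (x |: A)| =
          (#|K| - #|A|) * #|perms_covering K A|)%N.
  transitivity (\sum_(y in ~: A) #|perms_covering K (y |: A)|)%N.
    rewrite -sum_nat_const; apply: eq_bigr => y; rewrite inE => yA.
    by apply/eqP; rewrite eqn_leq !card_perms_covering_sym.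
  transitivity (\sum_(s in perms_covering K A) #|s @: K :\: A|)%N.
    under eq_bigr do rewrite -sum1_card.
    under [RHS]eq_bigr do rewrite -sum1_card.
    rewrite (exchange_big_dep (mem (perms_covering K A))) /=.
      apply: eq_bigr => s; rewrite !inE => sA; apply: eq_bigl => y.
      by rewrite !inE subUset sub1set sA andbT.
    by move=> y s _; rewrite !inE subUset => /andP[].
  rewrite mulnC -sum_nat_const; apply: eq_bigr => s; rewrite inE => sA.
  by rewrite cardsD (setIidPr sA) card_imset //; exact: perm_inj.
(* With [a = #|A|], [c = #|~: A|] and [k = #|K|], what remains is [(a + c) (k - a) <= k c], true
   because [k <= a + c]. *)
rewrite -(leq_pmul2l AT) mulnCA E !mulnA leq_mul2r; apply/orP; right.
have := max_card (mem K); rewrite -cT; move: (#|A|) (#|~: A|) (#|K|) => a c k kac; nia.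
Qed.


(** Negative correlation: a sample without replacement covers [A] at most as often as independent
    choices at rate [r] would. *)
Lemma card_perms_covering_le K A (r : R) :
  0 <= r -> #|K|%:R <= r * #|T|%:R ->
  #|perms_covering K A|%:R <= r ^+ #|A| * (#|{perm T}|%:R).
Proof.
move=> r0 Kr; elim: {A}(#|A|) {-2}A (erefl #|A|) => [|a IH] A cA.
  by rewrite cA expr0 mul1r ler_nat max_card.
have /set0Pn[x xA] : A != finset.set0 by rewrite -card_gt0 cA.
have xD : x \notin A :\ x by rewrite !inE eqxx.
have T0 : 0 < #|T|%:R :> R by rewrite ltr0n; apply/card_gt0P; exists x.
have cD : #|A :\ x| = a by move: cA; rewrite (cardsD1 x A) xA => -[].
have := card_perms_coveringU1 K xD; rewrite setD1K // -(ler_nat R) !natrM => H.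
rewrite -(ler_pM2l T0) (le_trans H) // cA exprS -cD.
rewrite (le_trans (ler_pM _ _ Kr (IH _ cD))) //.
by rewrite le_eqVlt; apply/orP; left; apply/eqP; ring.
Qed.

(** Both sides expand over subsets [B]; since [u] is nonnegative, the covering bound compares them
    term by term. *)
Lemma sum_prod_random_subset K u (r : R) :
  0 <= r -> #|K|%:R <= r * #|T|%:R -> (forall i, 0 <= u i) ->
  \sum_(s : {perm T}) \prod_(i in s @: K) (1 + u i)
    <= #|{perm T}|%:R * \prod_i (1 + r * u i).
Proof.
move=> r0 Kr u0.
have E (A : {set T}) : \prod_(i in A) (1 + u i) =
    \sum_(B : {set T} | B \subset A) \prod_(i in B) u i.
  rewrite big_mkcond /=.
  transitivity (\prod_i ((if i \in A then u i else 0) + 1)).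
    by apply: eq_bigr => i _; case: ifP => _; rewrite ?add0r // addrC.
  rewrite bigA_distr [RHS]big_mkcond; apply: eq_bigr => B _.
  rewrite [X in if _ then X else _]big_mkcond /=.
  case: ifP => [BA|/negbT/subsetPn[i iB iA]].
    by apply: eq_bigr => i _; case: ifP => // /(subsetP BA) ->.
  by rewrite (bigD1 i) //= iB (negbTE iA) mul0r.
rewrite (eq_bigr _ (fun s _ => E (s @: K))).
have -> : \prod_i (1 + r * u i) = \sum_(B : {set T}) r ^+ #|B| * \prod_(i in B) u i.
  under eq_bigr do rewrite addrC.
  rewrite bigA_distr; apply: eq_bigr => B _.
  by rewrite -prodr_const -big_split /= [RHS]big_mkcond.
rewrite (exchange_big_dep predT) //= mulr_sumr; apply: ler_sum => B _.
rewrite sumr_const -[X in X <= _]mulr_natl mulrA ler_wpM2r ?prodr_ge0 //.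
have := card_perms_covering_le B r0 Kr; rewrite [X in _ <= X]mulrC.
by rewrite /perms_covering cardsE.
Qed.

(** Convexity of the exponential, by averaging its tangent inequality at [e * x] over the endpoints
    0 and [e]. *)
Lemma expR_chord (e x : R) : 0 <= x -> x <= 1 -> expR (e * x) <= 1 - x + x * expR e.
Proof.
move=> x0 x1.
have H1 : expR (e * x) * (1 - e * x) <= 1.
  by rewrite -ler_pdivlMl ?expR_gt0 // mulr1 -expRN expR_ge1Dx.
have H2 : expR (e * x) * (1 + e * (1 - x)) <= expR e.
  by rewrite -ler_pdivlMl ?expR_gt0 // -expRN -expRD (le_trans _ (expR_ge1Dx _)) // lerD2l; lra.
have E : expR (e * x) = (1 - x) * (expR (e * x) * (1 - e * x)) + x * (expR (e * x) * (1 + e * (1 - x))) by ring.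
rewrite [X in X <= _]E lerD // ?ler_wpM2l //.
by rewrite -[X in _ <= X]mulr1 ler_wpM2l // subr_ge0.
Qed.

Lemma card_set_le_expR_sum (f : {perm T} -> R) (t : R) :
  #|[set s | t <= f s]|%:R <= expR (- t) * \sum_s expR (f s).
Proof.
rewrite -sum1_card natr_sum mulr_sumr big_mkcond /=; apply: ler_sum => s _.
rewrite inE -expRD; case: ifP => [tf|_]; last exact: expR_ge0.
by rewrite -expR0 ler_expR addrC subr_ge0.
Qed.

(** Charging [- mu] to every element leaves a product of factors [1 + u i >= 1] over the random set.
    Comparison with independent sampling then gives one factor per element, at most 1 by the chord
    bound and the hypothesis on [eta] and [mu]. *)
Lemma chernoff_random_subset K b (r eta mu d t : R) :
  0 <= r -> r <= 1 -> #|K|%:R <= r * #|T|%:R -> 0 <= eta -> 0 <= mu -> 0 < d ->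
  (forall i, 0 <= b i <= d) -> r * expR eta + (1 - r) * expR (- mu) <= 1 ->
  #|[set s : {perm T} | t * d <= eta * (\sum_(i in s @: K) b i)
                              - mu * (\sum_(i in ~: (s @: K)) b i)]|%:R
    <= expR (- t) * #|{perm T}|%:R.
Proof.
move=> r0 r1 Kr eta0 mu0 d0 bd mgf.
pose c i := b i / d.
have c0 i : 0 <= c i by have /andP[? _] := bd i; rewrite divr_ge0 // ltW.
have c1 i : c i <= 1 by have /andP[_ ?] := bd i; rewrite ler_pdivrMr ?mul1r.
pose f (s : {perm T}) := eta * (\sum_(i in s @: K) c i) - mu * (\sum_(i in ~: (s @: K)) c i).
have -> : [set s : {perm T} | t * d <= eta * (\sum_(i in s @: K) b i)
                              - mu * (\sum_(i in ~: (s @: K)) b i)] = [set s | t <= f s].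
  apply/setP => s; rewrite !inE -ler_pdivlMr // /f mulrBl -!mulrA.
  by rewrite !big_distrl.
apply: le_trans (card_set_le_expR_sum f t) _; rewrite ler_wpM2l ?expR_ge0 //.
pose u i := expR ((eta + mu) * c i) - 1.
have u0 i : 0 <= u i by rewrite subr_ge0 -expR0 ler_expR mulr_ge0 ?addr_ge0.
have E s : expR (f s) = (\prod_i expR (- mu * c i)) * \prod_(i in s @: K) (1 + u i).
  transitivity (expR (\sum_i (- mu * c i) + \sum_(i in s @: K) ((eta + mu) * c i))).
    congr expR; rewrite /f -!mulr_sumr [in RHS](bigID (mem (s @: K))) /=.
    under [X in _ - mu * X]eq_bigl do rewrite inE.
    ring.
  rewrite expRD !expR_sum; congr (_ * _); apply: eq_bigr => i _.
  by rewrite /u [RHS]addrC subrK.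
rewrite (eq_bigr _ (fun s _ => E s)).
rewrite -mulr_sumr.
have Pm : 0 <= \prod_i expR (- mu * c i) by apply: prodr_ge0 => i _; exact: expR_ge0.
apply: le_trans (ler_wpM2l Pm (sum_prod_random_subset r0 Kr u0)) _.
rewrite mulrCA -[X in _ <= X]mulr1 ler_wpM2l // -big_split /=.
apply: prodr_ile1 => i _; rewrite mulr_ge0 ?expR_ge0 ?addr_ge0 ?mulr_ge0 //=.
have -> : expR (- mu * c i) * (1 + r * u i) =
    r * expR (eta * c i) + (1 - r) * expR (- mu * c i).
  have H : expR (- mu * c i) * expR ((eta + mu) * c i) = expR (eta * c i).
    by rewrite -expRD; congr expR; ring.
  by rewrite -H /u; ring.
have r1' : 0 <= 1 - r by rewrite subr_ge0.
apply: le_trans (lerD (ler_wpM2l r0 (expR_chord eta (c0 i) (c1 i))) (ler_wpM2l r1' (expR_chord (- mu) (c0 i) (c1 i)))) _.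
have -> : r * (1 - c i + c i * expR eta) + (1 - r) * (1 - c i + c i * expR (- mu))
  = 1 - c i + c i * (r * expR eta + (1 - r) * expR (- mu)) by ring.
by rewrite -[X in _ <= X](subrK (c i)) lerD2l -[X in _ <= X]mulr1 ler_wpM2l.
Qed.

End RandomSubset.

Section Prices.
Variables (R : realType) (n m : nat) (Opt : finType) (Q : packing R n m Opt).
Implicit Types (i : 'I_n) (j : 'I_m) (c : option Opt) (beta : 'I_m -> R).
Implicit Types (S : {set 'I_n}) (F : {ffun 'I_n -> {set option Opt}}).

Definition alt_value i c : R := if c is Some o then value Q i o else 0.

Definition alt_need i c j : R := if c is Some o then norm_need Q i o j else 0.

Lemma alt_gainE beta i c :
  alt_gain Q beta i c = alt_value i c - \sum_j beta j * alt_need i c j.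
Proof.
by case: c => //=; rewrite sub0r big1 ?oppr0 // => j _; rewrite mulr0.
Qed.

(** All maximisers are recorded, since optimal prices may leave ties in the sample. The union bound
    ranges over the values of this function. *)
Definition best_alternatives beta : {ffun 'I_n -> {set option Opt}} :=
  [ffun i => [set c | alternative Q i c &&
    [forall c', alternative Q i c' ==> (alt_gain Q beta i c' <= alt_gain Q beta i c)]]].

Lemma best_alternativesP beta i c :
  reflect (max_gain Q beta i c) (c \in best_alternatives beta i).
Proof.
rewrite ffunE inE; apply: (iffP andP) => -[ac H]; split => //.
  by move=> c' ac'; have /forallP/(_ c')/implyP/(_ ac') := H.
by apply/forallP => c'; apply/implyP => /H.
Qed.

Lemma best_option_best beta i : best_option Q beta i \in best_alternatives beta i.
Proof.
apply/best_alternativesP; rewrite /best_option; case: pickP => [o /andP[oi /andP[g0 H]]|H].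
  split => // -[o' oi'|_] //=; have /forallP/(_ o')/implyP := H; exact.
(* If no option qualifies, the maximiser must be [None]: an option would have gain at least that of
   [None], which is 0, and would qualify. *)
pose c0 := [arg max_(c > None | alternative Q i c) alt_gain Q beta i c]%O.
have [ac0 mc0] : alternative Q i c0 /\
    forall c, alternative Q i c -> alt_gain Q beta i c <= alt_gain Q beta i c0.
  by rewrite /c0; case: arg_maxP.
case: c0 ac0 mc0 => [o|] ac0 mc0; last by split.
have := H o; rewrite (mc0 None) //= andbC.
have -> : [forall o' in opts Q i, gain Q beta i o' <= gain Q beta i o].
  by apply/forallP => o'; apply/implyP => oi'; exact: (mc0 (Some o')).
by rewrite (ac0 : o \in opts Q i).
Qed.

Lemma no_tie_best_alternatives beta i :
  no_tie Q beta i -> best_alternatives beta i = [set best_option Q beta i].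
Proof.
move=> nt; apply/setP => c; rewrite inE; apply/idP/eqP => [/best_alternativesP cb|->].
  by apply: nt => //; apply/best_alternativesP; exact: best_option_best.
exact: best_option_best.
Qed.

Definition surplus beta i : R := alt_gain Q beta i (best_option Q beta i).

Lemma alt_gain_le_surplus beta i c :
  alternative Q i c -> alt_gain Q beta i c <= surplus beta i.
Proof. by have /best_alternativesP[_] := best_option_best beta i; apply. Qed.

Lemma surplus_ge0 beta i : 0 <= surplus beta i.
Proof. exact: (@alt_gain_le_surplus beta i None). Qed.

Lemma dual_feasible_surplus beta S :
  (forall j, 0 <= beta j) -> dual_feasible Q S beta (surplus beta).
Proof.
move=> b0; split => // [i _|i o _ oi]; first exact: surplus_ge0.
by rewrite -lerBlDr; exact: (@alt_gain_le_surplus beta i (Some o)).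
Qed.

(** For fixed prices the surpluses are the smallest feasible [z] on [S], so [z] can be eliminated
    from the dual. *)
Lemma optimal_prices_surplus eps S beta : optimal_prices Q eps S beta ->
  (forall j, 0 <= beta j) /\
  forall beta', (forall j, 0 <= beta' j) ->
    dual_objective eps S beta (surplus beta) <= dual_objective eps S beta' (surplus beta').
Proof.
move=> [z [[b0 z0 zo] H]]; split => // beta' b'0.
apply: le_trans (H _ _ (dual_feasible_surplus S b'0)); rewrite lerD2l.
apply: ler_sum => i iS; rewrite /surplus.
have /best_alternativesP[] := best_option_best beta i.
case: best_option => [o|] /= oi _; last exact: z0.
by rewrite /gain lerBlDr; exact: zo.
Qed.

Section Load.
Variable d : R.
Hypothesis d_gt0 : 0 < d.
Hypothesis need_bound : forall i o j, o \in opts Q i -> 0 <= norm_need Q i o j <= d.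

(* Tied agents all lie in the sample, where the optimal prices do not determine
   their choice: [h = 0] underestimates what they use and [h = d] overestimates it. *)
Definition load (h : R) F j i : R :=
  if #|F i| == 1%N then \sum_(c in F i) alt_need i c j else h.

Lemma alt_need_bound i c j : alternative Q i c -> 0 <= alt_need i c j <= d.
Proof. by case: c => [o|_] /=; [exact: need_bound | rewrite lexx ltW]. Qed.

Lemma load_bound h F j i : 0 <= h <= d ->
  (forall c, c \in F i -> alternative Q i c) -> 0 <= load h F j i <= d.
Proof.
move=> hd aF; rewrite /load; case: ifP => // /cards1P[c Fc].
by rewrite Fc big_set1; apply/alt_need_bound/aF; rewrite Fc set11.
Qed.

Lemma alternative_best beta i c : c \in best_alternatives beta i -> alternative Q i c.
Proof. by move=> /best_alternativesP[]. Qed.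

Lemma load_no_tie h beta j i : no_tie Q beta i ->
  load h (best_alternatives beta) j i = alt_need i (best_option Q beta i) j.
Proof. by move=> /no_tie_best_alternatives nt; rewrite /load nt cards1 eqxx big_set1. Qed.

Lemma best_alternatives_gap beta : exists2 t0 : R, 0 < t0 &
  forall i c, alternative Q i c -> c \notin best_alternatives beta i ->
    alt_gain Q beta i c + t0 <= surplus beta i.
Proof.
pose P (p : 'I_n * option Opt) := alternative Q p.1 p.2 && (p.2 \notin best_alternatives beta p.1).
pose f (p : 'I_n * option Opt) := surplus beta p.1 - alt_gain Q beta p.1 p.2.
(* The default 1 keeps the minimum positive even if every alternative is a best one. *)
exists (\big[Num.min/1]_(p | P p) f p).
  elim/big_ind: _ => // [x y x0 y0|[i c] /andP[/= ac nb]]; first by rewrite lt_min x0.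
  rewrite subr_gt0 lt_neqAle alt_gain_le_surplus // andbT; apply: contraNneq nb => e.
  apply/best_alternativesP; split => // c' ac'; rewrite e; exact: alt_gain_le_surplus.
move=> i c ac nb; rewrite -lerBrDl; apply: (@bigmin_le_cond _ _ _ _ (i, c) P f).
by rewrite /P /= ac nb.
Qed.

Definition shift_price beta j (t : R) : 'I_m -> R := fun k => beta k + (k == j)%:R * t.

Lemma alt_gain_shift beta j (t : R) i c :
  alt_gain Q (shift_price beta j t) i c = alt_gain Q beta i c - t * alt_need i c j.
Proof.
rewrite !alt_gainE; under eq_bigr do rewrite mulrDl.
rewrite big_split /= opprD addrA; congr (_ - _).
rewrite (bigD1 j) //= eqxx mul1r big1 ?addr0 // => k /negPf ->.
by rewrite !mul0r.
Qed.

(** For a step below the gap, a unique best alternative stays best, so the surplus moves linearly.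
    For a tied agent crude bounds are used: a higher price does not raise the surplus, and a lower
    one raises it by at most [t * d]. *)
Lemma surplus_shift beta j (t : R) : 0 < t ->
  (forall i c, alternative Q i c -> c \notin best_alternatives beta i ->
    alt_gain Q beta i c + t * d <= surplus beta i) ->
  forall i,
  surplus (shift_price beta j t) i <= surplus beta i - t * load 0 (best_alternatives beta) j i
  /\
  surplus (shift_price beta j (- t)) i <= surplus beta i + t * load d (best_alternatives beta) j i.
Proof.
move=> t0 gap i.
have key (t' : R) c : `|t'| = t -> #|best_alternatives beta i| == 1%N -> alternative Q i c ->
    alt_gain Q beta i c - t' * alt_need i c j
      <= surplus beta i - t' * \sum_(c in best_alternatives beta i) alt_need i c j.
  move=> tt' /cards1P[b bE] ac; rewrite bE big_set1.
  have bb : b \in best_alternatives beta i by rewrite bE set11.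
  have ab := alternative_best bb.
  have [cb|cb] := boolP (c \in best_alternatives beta i).
    by move: cb; rewrite bE inE => /eqP ->; rewrite lerD2r alt_gain_le_surplus.
  have /andP[b0 bd] := alt_need_bound j ab; have /andP[c0 cd] := alt_need_bound j ac.
  have g := gap _ _ ac cb.
  have : `|t' * (alt_need i b j - alt_need i c j)| <= t * d.
    rewrite normrM tt' ler_wpM2l ?(ltW t0) // ler_norml; apply/andP; split; lra.
  rewrite ler_norml => /andP[_ H]; lra.
have nb t' := alternative_best (best_option_best (shift_price beta j t') i).
split; rewrite {1}/surplus alt_gain_shift /load.
  case: ifP => [u|_]; first by apply: (key t) => //; rewrite gtr0_norm.
  rewrite mulr0 subr0 (le_trans _ (alt_gain_le_surplus beta (nb t))) //.
  by rewrite lerBlDr lerDl mulr_ge0 ?(ltW t0) //; case/andP: (alt_need_bound j (nb t)).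
case: ifP => [u|_].
  by rewrite mulNr opprK; have := key (- t) _ _ u (nb (- t)); rewrite normrN gtr0_norm // !mulNr !opprK; apply.
rewrite mulNr opprK lerD ?alt_gain_le_surplus //.
by rewrite ler_wpM2l ?(ltW t0) //; case/andP: (alt_need_bound j (nb (- t))).
Qed.

(* The one-sided partial derivatives of the dual objective at an optimum are
   nonnegative; they are computed by the loads of the sample. *)
Lemma optimal_prices_load eps S beta j : optimal_prices Q eps S beta ->
  \sum_(i in S) load 0 (best_alternatives beta) j i <= eps /\
  (0 < beta j -> eps <= \sum_(i in S) load d (best_alternatives beta) j i).
Proof.
move=> /optimal_prices_surplus[b0 H].
have [t0 t00 gap] := best_alternatives_gap beta.
have sumE t : \sum_k eps * shift_price beta j t k = \sum_k eps * beta k + eps * t.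
  under eq_bigr do rewrite mulrDr.
  rewrite big_split /=; congr (_ + _).
  rewrite (bigD1 j) //= eqxx mul1r big1 ?addr0 // => k /negPf ->.
  by rewrite mul0r mulr0.
have gap' t : 0 < t -> t <= t0 / d -> forall i c, alternative Q i c ->
    c \notin best_alternatives beta i -> alt_gain Q beta i c + t * d <= surplus beta i.
  move=> tp tl i c ac nb; apply: le_trans (gap _ _ ac nb).
  by rewrite lerD2l -ler_pdivlMr.
have td : 0 < t0 / d by rewrite divr_gt0.
split.
  have sh i := surplus_shift j td (gap' _ td (lexx _)) i.
  have /H : forall k, 0 <= shift_price beta j (t0 / d) k.
    by move=> k; rewrite addr_ge0 // mulr_ge0 ?ler0n // ltW.
  rewrite /dual_objective sumE -addrA lerD2l => H1.
  have : \sum_(i in S) surplus (shift_price beta j (t0 / d)) i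
      <= \sum_(i in S) surplus beta i - t0 / d * \sum_(i in S) load 0 (best_alternatives beta) j i.
    by rewrite mulr_sumr -sumrB; apply: ler_sum => i _; case: (sh i).
  move=> H2; rewrite -(ler_pM2l td); lra.
(* The step is capped by [beta j] to keep the lowered price nonnegative. *)
move=> bj; pose t := Num.min (t0 / d) (beta j).
have tp : 0 < t by rewrite lt_min td.
have tl : t <= t0 / d by rewrite ge_min lexx.
have sh i := surplus_shift j tp (gap' _ tp tl) i.
have /H : forall k, 0 <= shift_price beta j (- t) k.
  move=> k; rewrite /shift_price; have [->|_] := eqVneq k j; last by rewrite mul0r addr0.
  by rewrite mul1r subr_ge0 ge_min lexx orbT.
rewrite /dual_objective sumE -addrA lerD2l => H1.
have : \sum_(i in S) surplus (shift_price beta j (- t)) i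
    <= \sum_(i in S) surplus beta i + t * \sum_(i in S) load d (best_alternatives beta) j i.
  by rewrite mulr_sumr -big_split; apply: ler_sum => i _; case: (sh i).
move=> H2; rewrite -(ler_pM2l tp); lra.
Qed.

End Load.

End Prices.

(** * Counting the profiles of best alternatives; Lagrangian duality *)

Section Cover.
Variables (R : realType) (n m : nat) (Opt : finType) (Q : packing R n m Opt).
Implicit Types (i : 'I_n) (j : 'I_m) (c : option Opt) (beta : 'I_m -> R).
Implicit Types (S : {set 'I_n}) (F : {ffun 'I_n -> {set option Opt}}).

(* Prices are homogenised by a leading coordinate 1, so that differences of
   gains become linear forms. *)
Definition gain_form i c c' : 'cV[R]_m.+1 :=
  \col_k (if unlift ord0 k is Some j then - (alt_need Q i c j - alt_need Q i c' j)
          else alt_value Q i c - alt_value Q i c').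

Definition price_point beta : 'rV[R]_m.+1 :=
  \row_k (if unlift ord0 k is Some j then beta j else 1).

Lemma price_point_gain_form beta i c c' :
  (price_point beta *m gain_form i c c') 0 0 = alt_gain Q beta i c - alt_gain Q beta i c'.
Proof.
rewrite mxE big_ord_recl !mxE unlift_none mul1r.
under eq_bigr do rewrite !mxE liftK mulrN mulrBr.
rewrite sumrN sumrB !alt_gainE; ring.
Qed.

(** Defined at all [y], because the representative of a sign pattern need not be a [price_point]. *)
Definition form_best_alternatives (y : 'rV[R]_m.+1) : {ffun 'I_n -> {set option Opt}} :=
  [ffun i => [set c | alternative Q i c && [forall c', alternative Q i c' ==>
    (0 <= Num.sg ((y *m gain_form i c c') 0 0))]]].

Lemma best_alternatives_cover : (0 < n)%N -> (0 < max_options Q)%N ->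
  exists L : seq {ffun 'I_n -> {set option Opt}},
  [/\ (size L <= (13 * (n * max_options Q ^ 2)) ^ m.+1)%N,
      forall F i c, F \in L -> c \in F i -> alternative Q i c
    & forall beta, best_alternatives Q beta \in L].
Proof.
move=> n0 q0; set q := max_options Q.
pose alts i := None :: [seq Some o | o <- enum (opts Q i)].
have altsP i c : alternative Q i c -> c \in alts i.
  case: c => [o|_] //= oi; rewrite inE /=; apply/mapP; exists o => //.
  by rewrite mem_enum.
pose fs := flatten [seq [seq gain_form i c c' | c <- alts i, c' <- alts i] | i <- enum 'I_n].
have szfs : (size fs <= n * q.+1 ^ 2)%N.
  rewrite -[X in (_ <= X * _)%N](size_enum_ord n) /fs.
  elim: (enum 'I_n) => [|i s IH] //; rewrite map_cons -[flatten _]/(_ ++ flatten _) size_cat [size (i :: s)]/= mulSn leq_add //.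
  have szi : (size (alts i) <= q.+1)%N.
    by rewrite /= size_map -cardE ltnS; exact: (leq_bigmax i).
  by rewrite size_allpairs expnS expn1 leq_mul.
have [B [szB HB]] := sign_pattern_cover (erefl (size fs)).
exists (map form_best_alternatives B); split.
(* There are [N <= n (q + 1)^2 <= 4 n q^2] forms, so [3 N + 1 <= 13 n q^2]. *)
- rewrite size_map (leq_trans szB) // leq_exp2r //.
  move: szfs; rewrite -/q in q0 *; move: (size fs) => N szN; nia.
- by move=> F i c /mapP[y _ ->]; rewrite ffunE inE => /andP[].
move=> beta; have [y yB Hy] := HB (price_point beta).
apply/mapP; exists y => //; apply/ffunP => i; rewrite !ffunE; apply/setP => c.
rewrite !inE; case ac : (alternative Q i c) => //=; apply: eq_forallb => c'.
case ac' : (alternative Q i c') => //=.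
rewrite Hy ?price_point_gain_form ?sgr_ge0 ?subr_ge0 //.
apply/flattenP; exists [seq gain_form i c c' | c <- alts i, c' <- alts i].
  by apply/mapP; exists i; rewrite ?mem_enum.
by apply/allpairsP; exists (c, c'); rewrite /= !altsP.
Qed.

Hypothesis cap_gt0 : forall j, 0 < cap Q j.

Lemma usageE (x : {ffun 'I_n -> option Opt}) j :
  usage Q x j = cap Q j * \sum_i alt_need Q i (x i) j.
Proof.
rewrite mulr_sumr; apply: eq_bigr => i _; case: (x i) => [o|] /=; last by rewrite mulr0.
by rewrite /norm_need mulrCA divff ?mulr1 // gt_eqF.
Qed.

Lemma total_valueE (x : {ffun 'I_n -> option Opt}) beta :
  total_value Q x = \sum_i alt_gain Q beta i (x i)
    + \sum_j beta j * \sum_i alt_need Q i (x i) j.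
Proof.
under [in RHS]eq_bigr do rewrite alt_gainE.
under [X in _ + X]eq_bigr do rewrite mulr_sumr.
by rewrite exchange_big /= -big_split /=; apply: eq_bigr => i _; rewrite subrK.
Qed.

(** Meant for allocations feasible under the original capacities, which exceed the shrunken ones by
    the factor [k]. *)
Lemma weak_duality (x : {ffun 'I_n -> option Opt}) (k : R) beta : 1 <= k ->
  (forall j, 0 <= beta j) -> (forall i, alternative Q i (x i)) ->
  (forall j, usage Q x j <= k * cap Q j) ->
  total_value Q x <= k * (\sum_j beta j + \sum_i surplus Q beta i).
Proof.
move=> k1 b0 ax ux; rewrite (total_valueE x beta) mulrDr addrC lerD //.
  rewrite mulr_sumr; apply: ler_sum => j _; rewrite mulrC ler_wpM2r //.
  by have := ux j; rewrite usageE mulrC ler_pM2r.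
apply: (@le_trans _ _ (\sum_i surplus Q beta i)).
  by apply: ler_sum => i _; exact: alt_gain_le_surplus.
by rewrite ler_peMl // sumr_ge0 // => i _; exact: surplus_ge0.
Qed.

(** Without ties the load is the actual need, so one identity serves both [h = 0] for feasibility
    and [h = d] for the value. *)
Lemma alloc_need S beta h j : (forall i, i \notin S -> no_tie Q beta i) ->
  \sum_i alt_need Q i (training_based_alloc Q S beta i) j
  = \sum_(i in ~: S) load Q h (best_alternatives Q beta) j i.
Proof.
move=> nt; rewrite [RHS]big_mkcond; apply: eq_bigr => i _; rewrite ffunE inE.
by case: ifPn => //= iS; rewrite load_no_tie //; exact: nt.
Qed.

Lemma alloc_value S beta h : (forall i, i \notin S -> no_tie Q beta i) ->
  total_value Q (training_based_alloc Q S beta) = \sum_(i in ~: S) surplus Q beta i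
   + \sum_j beta j * \sum_(i in ~: S) load Q h (best_alternatives Q beta) j i.
Proof.
move=> nt; rewrite (total_valueE _ beta); congr (_ + _).
  rewrite [RHS]big_mkcond; apply: eq_bigr => i _; rewrite ffunE inE.
  by case: ifP.
by apply: eq_bigr => j _; rewrite (alloc_need h).
Qed.

Lemma alternative_alloc S beta i : alternative Q i (training_based_alloc Q S beta i).
Proof.
rewrite ffunE; case: ifP => // _; exact: alternative_best (best_option_best _ _ _).
Qed.

End Cover.

(** * Exponential inequalities and the choice of tail parameters *)

Lemma expR_mul1B_le1 (R : realType) (x : R) : expR x * (1 - x) <= 1.
Proof. by rewrite -ler_pdivlMl ?expR_gt0 // mulr1 -expRN expR_ge1Dx. Qed.

(** Bounding both exponentials by [expR x <= 1 / (1 - x)] and clearing denominators turns the claim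
    into the last hypothesis. *)
Lemma expR_mix_le1 (R : realType) (r eta mu : R) :
  0 <= r <= 1 -> eta < 1 -> -1 < mu ->
  r * (eta + mu) <= mu * (1 - eta) ->
  r * expR eta + (1 - r) * expR (- mu) <= 1.
Proof.
move=> /andP[r0 r1] eta1 mu1 H.
have e0 : 0 < 1 - eta by lra.
have m0 : 0 < 1 + mu by lra.
have H1 : expR eta <= (1 - eta)^-1.
  by rewrite -[X in _ <= X]mul1r ler_pdivlMr // expR_mul1B_le1.
have H2 : expR (- mu) <= (1 + mu)^-1.
  by rewrite -[X in _ <= X]mul1r ler_pdivlMr // -[X in 1 + X]opprK expR_mul1B_le1.
have r1' : 0 <= 1 - r by lra.
apply: le_trans (lerD (ler_wpM2l r0 H1) (ler_wpM2l r1' H2)) _.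
rewrite -(ler_pM2r e0) -(ler_pM2r m0).
have -> : (r * (1 - eta)^-1 + (1 - r) * (1 + mu)^-1) * (1 - eta) * (1 + mu) =
  r * (1 + mu) + (1 - r) * (1 - eta) by field; rewrite ?gt_eqF.
nra.
Qed.

Lemma expR1_le4 (R : realType) : expR (1 : R) <= 4.
Proof.
have h : expR (2^-1 : R) <= 2.
  by have := expR_mul1B_le1 (2^-1 : R); lra.
have -> : (1 : R) = 2^-1 + 2^-1 by lra.
have h0 := expR_ge0 (2^-1 : R).
rewrite expRD; nra.
Qed.

(** Monotonicity reduces the estimate on [[a, b]] to a rational inequality at the endpoints, as
    [exp (- 2 e^3) >= (1 - e^3 / 4)^8]. *)
Lemma one_minus_le_expR_cube_itv (R : realType) (a b e : R) :
  a <= e -> e <= b -> 0 <= a -> b <= 1 ->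
  1001 / 1000 - a <= 98 / 100 * (1 - b ^+ 3 / 4) ^+ 8 ->
  1001 / 1000 - e <= 98 / 100 * expR (- (2 * e ^+ 3)).
Proof.
move=> ae eb a0 b1 H; apply: (@le_trans _ _ (1001 / 1000 - a)); first by lra.
apply: le_trans H _; rewrite ler_wpM2l ?divr_ge0 //.
have -> : - (2 * e ^+ 3) = 8%:R * - (e ^+ 3 / 4) by lra.
rewrite expRM_natl.
have e3b : e ^+ 3 <= b ^+ 3 by rewrite lerXn2r ?nnegrE; lra.
have b31 : b ^+ 3 <= 1 by rewrite exprn_ile1 //; lra.
rewrite lerXn2r ?nnegrE ?expR_ge0 //; first by lra.
by apply: le_trans (expR_ge1Dx _); lra.
Qed.

(** In [lower_tail_parameters] the slack in [1001 / 1000] absorbs the rounding of the sample size,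
    and that in [98 / 100] absorbs [expR (- 99)] and [expR 100^-1]. *)
Lemma one_minus_le_expR_cube (R : realType) (e : R) : 4^-1 <= e -> e <= 1 ->
  1001 / 1000 - e <= 98 / 100 * expR (- (2 * e ^+ 3)).
Proof.
move=> e4 e1.
have [?|/ltW e40] := leP e (4 / 10).
  by apply: (@one_minus_le_expR_cube_itv _ (1/4) (4/10)); lra.
have [?|/ltW e55] := leP e (55 / 100).
  by apply: (@one_minus_le_expR_cube_itv _ (4/10) (55/100)); lra.
have [?|/ltW e70] := leP e (7 / 10).
  by apply: (@one_minus_le_expR_cube_itv _ (55/100) (7/10)); lra.
have [?|/ltW e80] := leP e (8 / 10).
  by apply: (@one_minus_le_expR_cube_itv _ (7/10) (8/10)); lra.
have [?|/ltW e87] := leP e (87 / 100).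
  by apply: (@one_minus_le_expR_cube_itv _ (8/10) (87/100)); lra.
have [?|/ltW e94] := leP e (94 / 100).
  by apply: (@one_minus_le_expR_cube_itv _ (87/100) (94/100)); lra.
by apply: (@one_minus_le_expR_cube_itv _ (94/100) 1); lra.
Qed.

(* For [eps] bounded away from 0 the exponent that can be reached stays bounded
   however much the capacities are shrunk, since all of the load may miss the
   sample with probability about [(1 - eps) ^ (1 / d)]; that it still exceeds the
   factor 2 needed by the union bound is the inequality
   [- ln (1 - eps) > 2 * eps ^+ 3]. *)
Lemma lower_tail_parameters (R : realType) (eps p : R) : 0 < eps -> eps < 1 ->
  eps - eps ^+ 3 / 2 <= p -> eps - 1000^-1 <= p -> p <= eps -> 0 <= p ->
  exists eta mu : R, [/\ 0 <= eta, 0 <= mu,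
    (1 - p) * expR mu + p * expR (- eta) <= 1 &
    2 * eps ^+ 3 * (1 + 10000 * eps) <= mu * (1 + 10000 * eps) - eta * eps].
Proof.
move=> e0 e1 p1 p2 pe p0.
have ee : 0 <= eps ^+ 2 by rewrite exprn_ge0 // ltW.
have [e4|/ltW e4] := leP eps 4^-1.
  (* In the deviation the terms [eps^2] cancel, and the [10000 eps^3] gained by shrinking the
     capacities dominates the rest. *)
  exists eps, (eps ^+ 2 - eps ^+ 3).
  have H1 : 0 <= eps ^+ 2 - eps ^+ 3 by nra.
  have H2 : eps ^+ 2 - eps ^+ 3 <= 2^-1 by nra.
  split; [lra | lra | | ].
    have := @expR_mix_le1 R (1 - p) (eps ^+ 2 - eps ^+ 3) eps.
    rewrite (_ : 1 - (1 - p) = p); last by ring.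
    apply; [apply/andP; split; lra | lra | lra | ].
    have : eps ^+ 2 * (1 - eps) * (1 + eps ^+ 3 / 2) <= eps ^+ 2 * (1 - eps ^+ 2 / 2).
      rewrite -mulrA ler_wpM2l //; nra.
    have : (eps ^+ 2 - eps ^+ 3 + eps) * (eps - eps ^+ 3 / 2) <= (eps ^+ 2 - eps ^+ 3 + eps) * p.
      by rewrite ler_wpM2l //; lra.
    nra.
  have : 0 <= eps ^+ 3 * (10000 * (1 - 3 * eps) - 3) by rewrite mulr_ge0 ?exprn_ge0 //; lra.
  nra.
(* A large [eta] makes [expR (- eta)] negligible; its cost [99 eps] is paid by [100^-1 * 10000 eps]
   from the second summand of [mu]. *)
exists 99, (2 * eps ^+ 3 + 100^-1).
have e3 : 0 <= eps ^+ 3 by rewrite exprn_ge0 // ltW.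
split; [lra | lra | | nra].
have F : expR (- 99 : R) <= 100^-1.
  by have := expR_mul1B_le1 (- 99 : R); lra.
have G : p * expR (- 99 : R) <= 100^-1.
  have := expR_ge0 (- 99 : R); nra.
have E := one_minus_le_expR_cube e4 (ltW e1).
have X0 := expR_gt0 (2 * eps ^+ 3).
have H100 : expR (100^-1 : R) <= 100 / 99.
  by have := expR_mul1B_le1 (100^-1 : R); lra.
have : (1 - p) * expR (2 * eps ^+ 3) <= 98 / 100.
  rewrite -ler_pdivlMr // -expRN; apply: (le_trans _ E); lra.
have : 0 <= (1 - p) * expR (2 * eps ^+ 3) by rewrite mulr_ge0 ?expR_ge0 //; lra.
rewrite expRD mulrA; have := expR_ge0 (100^-1 : R).
move: ((1 - p) * expR (2 * eps ^+ 3)) => Y W0 Y0 Y1.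
have := ler_pM Y0 W0 Y1 H100; lra.
Qed.

(** * Union bound over profiles and resources *)

Lemma union_bound (R : realType) (T : finType) (U : eqType) (L : seq U) (m : nat)
  (A : {set T}) (E : U -> 'I_m -> {set T}) (x : R) :
  (forall s, s \in A -> exists F j, F \in L /\ s \in E F j) ->
  (forall F j, F \in L -> #|E F j|%:R <= x) ->
  #|A|%:R <= (m * size L)%:R * x.
Proof.
move=> cov bd.
have H : (#|A| <= \sum_(F <- L) \sum_(j < m) #|E F j|)%N.
  have -> : (\sum_(F <- L) \sum_(j < m) #|E F j| =
      \sum_s \sum_(F <- L) \sum_(j < m) (s \in E F j))%N.
    rewrite [RHS]exchange_big; apply: eq_bigr => F _.
    rewrite [RHS]exchange_big; apply: eq_bigr => j _.
    by rewrite -sum1_card big_mkcond; apply: eq_bigr => s _; case: ifP.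
  rewrite -sum1_card big_mkcond; apply: leq_sum => s _.
  case: ifP => // /cov[F [j [FL sE]]].
  by rewrite (big_rem F FL) /= (bigD1 j) //= sE -addnA leq_addr.
apply: (@le_trans _ _ (\sum_(F <- L) \sum_(j < m) #|E F j|)%N%:R); first by rewrite ler_nat.
rewrite natr_sum big_seq.
apply: (@le_trans _ _ (\sum_(F <- L | F \in L) (m%:R * x))).
  apply: ler_sum => F FL; rewrite natr_sum.
  apply: (@le_trans _ _ (\sum_(j < m) x)); first by apply: ler_sum => j _; exact: bd.
  by rewrite sumr_const card_ord mulr_natl.
rewrite -big_seq big_const_seq count_predT iter_addr_0 -mulr_natr natrM.
by rewrite le_eqVlt; apply/orP; left; apply/eqP; ring.
Qed.

(* The size of the cover of [best_alternatives_cover], times the number of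
   resources, times the failure probability of each event. *)
Lemma union_bound_total (R : realType) (n m q : nat) : (1000 < n)%N -> (0 < q)%N ->
  (m * (13 * (n * q ^ 2)) ^ m.+1)%:R
    * expR (- (2 * ((m + 1)%:R * (ln n%:R + ln q%:R)))) <= 13 / n%:R :> R.
Proof.
move=> n0 q0.
have n0R : 0 < n%:R :> R by rewrite ltr0n; lia.
have q0R : 0 < q%:R :> R by rewrite ltr0n.
have -> : expR (- (2 * ((m + 1)%:R * (ln n%:R + ln q%:R)))) =
    ((n%:R * q%:R) ^+ (2 * m.+1))^-1 :> R.
  by rewrite expRN mulrA -natrM expRM_natl expRD !lnK ?posrE // addn1.
(* The powers of [q] cancel and [(13 / n)^(m+1)] is left: one factor is kept, the others are at most
   [1 / 2] and outweigh [m]. *)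
have -> : (m * (13 * (n * q ^ 2)) ^ m.+1)%:R * ((n%:R * q%:R) ^+ (2 * m.+1))^-1
   = 13 / n%:R * (m%:R * (13 / n%:R) ^+ m) :> R.
  rewrite natrM natrX !natrM exprM -mulrA -exprVn -exprMn.
  have -> : 13%:R * (n%:R * (q%:R * q%:R)) * ((n%:R * q%:R) ^+ 2)^-1 = 13 / n%:R :> R.
    by field; rewrite !gt_eqF.
  by rewrite exprS mulrCA.
rewrite -[X in _ <= X]mulr1 ler_wpM2l ?divr_ge0 ?ler0n //.
apply: (@le_trans _ _ (m%:R * (2^-1) ^+ m)).
  rewrite ler_wpM2l // lerXn2r ?nnegrE ?divr_ge0 ?invr_ge0 ?ler0n //.
  rewrite ler_pdivrMr // mulrC ler_pdivlMr // -natrM ler_nat; lia.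
by rewrite exprVn ler_pdivrMr ?exprn_gt0 // mul1r -natrX ler_nat ltnW // ltn_expl.
Qed.

(** * Tail bounds for the sample *)

Section SampleTails.
Variables (R : realType) (n : nat) (eps : R).
Hypotheses (eps_ge0 : 0 <= eps) (eps_le1 : eps <= 1).
Implicit Types (b : 'I_n -> R) (s : 'S_n).

Definition first_arrivals : {set 'I_n} := [set t : 'I_n | (t < Num.truncn (eps * n%:R))%N].

Lemma sampleE s : sample eps s = s @: first_arrivals.
Proof.
apply/setP => i; apply/imsetP/imsetP => -[t tk ->]; exists t => //; move: tk; by rewrite inE.
Qed.

Lemma imset_permC s (K : {set 'I_n}) : s @: (~: K) = ~: (s @: K).
Proof.
apply/setP => i; rewrite -(permKV s i) !inE !mem_imset ?inE //; exact: perm_inj.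
Qed.

Lemma card_first_arrivals : #|first_arrivals| = Num.truncn (eps * n%:R).
Proof.
have kn : (Num.truncn (eps * n%:R) <= n)%N.
  have k0 : 0 <= eps * n%:R by rewrite mulr_ge0.
  have /andP[k1 _] := truncn_itv k0.
  by rewrite -(ler_nat R) (le_trans k1) // ler_piMl.
by rewrite -sum1_card; under eq_bigl do rewrite inE; rewrite (big_ord_narrow kn) sum1_card card_ord.
Qed.

Lemma sample_upper_tail b (eta mu d t : R) : 0 <= eta -> 0 <= mu -> 0 < d ->
  (forall i, 0 <= b i <= d) -> eps * expR eta + (1 - eps) * expR (- mu) <= 1 ->
  #|[set s : 'S_n | t * d <= eta * (\sum_(i in sample eps s) b i)
                           - mu * (\sum_(i in ~: sample eps s) b i)]|%:R
    <= expR (- t) * #|{perm 'I_n}|%:R.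
Proof.
move=> eta0 mu0 d0 bd mgf; under eq_finset do rewrite sampleE.
apply: (@chernoff_random_subset R _ _ _ eps) => //.
have /andP[k1 _] := truncn_itv (mulr_ge0 eps_ge0 (ler0n R n)).
by rewrite card_first_arrivals card_ord.
Qed.

(** The complement of the sample is a random set too. Rounding down the sample size may push it
    above the fraction [1 - eps], hence the exact fraction [p]. *)
Lemma sample_lower_tail b (p eta mu d t : R) : 0 <= eta -> 0 <= mu -> 0 < d ->
  0 <= p -> p * n%:R = (Num.truncn (eps * n%:R))%:R -> p <= 1 ->
  (forall i, 0 <= b i <= d) -> (1 - p) * expR mu + p * expR (- eta) <= 1 ->
  #|[set s : 'S_n | t * d <= mu * (\sum_(i in ~: sample eps s) b i)
                           - eta * (\sum_(i in sample eps s) b i)]|%:R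
    <= expR (- t) * #|{perm 'I_n}|%:R.
Proof.
move=> eta0 mu0 d0 p0 pn p1 bd mgf; under eq_finset do rewrite sampleE.
have := @chernoff_random_subset R _ (~: first_arrivals) b (1 - p) mu eta d t.
under eq_finset do rewrite imset_permC setCK.
apply => //; rewrite ?subr_ge0 ?lerBlDr ?lerDl //; last by rewrite subKr.
have := cardsC first_arrivals; rewrite card_ord => H.
by rewrite mulrBl mul1r pn -card_first_arrivals -[in X in _ <= X - _]H natrD addrAC subrr add0r.
Qed.

End SampleTails.

(** * Arithmetic of the value estimate *)

Lemma upper_tail_contra (R : realType) (e k X Y : R) : 0 < e -> e <= 100^-1 ->
  k <= 3 / 2 -> e <= X -> e * X - e ^+ 2 * (1 + 6 * e) * Y < 2 * (k * e ^+ 3) ->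
  1 - 10 * e <= Y.
Proof.
move=> e0 e1 k1 eX H; rewrite leNgt; apply/negP => HY.
have e2 : 0 < e ^+ 2 by rewrite exprn_gt0.
have e3 : 0 < e ^+ 3 by rewrite exprn_gt0.
have H1 : e ^+ 2 <= e * X by rewrite expr2 ler_wpM2l // ltW.
have H2 : e ^+ 2 * (1 + 6 * e) * Y <= e ^+ 2 * (1 + 6 * e) * (1 - 10 * e).
  by rewrite ler_wpM2l ?(ltW HY) // mulr_ge0 ?(ltW e2) //; lra.
have H3 : k * e ^+ 3 <= 3 / 2 * e ^+ 3 by rewrite ler_wpM2r // ltW.
have H4 : 0 < e * e ^+ 3 by rewrite mulr_gt0.
(* The deviation would be at least [4 e^3 + 60 e^4], whereas the threshold [2 k e^3] is at most
   [3 e^3]. *)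
have H5 : e ^+ 2 * (1 + 6 * e) * (1 - 10 * e) = e ^+ 2 - 4 * e ^+ 3 - 60 * (e * e ^+ 3).
  by ring.
lra.
Qed.

Lemma upper_tail_mgf (R : realType) (e : R) : 0 < e -> e <= 100^-1 ->
  e * expR e + (1 - e) * expR (- (e ^+ 2 * (1 + 6 * e))) <= 1.
Proof.
move=> e0 e1; have e2 : 0 < e ^+ 2 by rewrite exprn_gt0.
apply: expR_mix_le1; [by apply/andP; split; lra | lra | nra | ].
have : 0 <= e ^+ 2 * (e * (4 - 12 * e)) by rewrite !mulr_ge0 //; lra.
nra.
Qed.

Lemma dual_tail_mgf (R : realType) (e : R) : 0 < e -> e <= 100^-1 ->
  e * expR 1 + (1 - e) * expR (- (4 * e)) <= 1.
Proof.
move=> e0 e1; have E4 := expR1_le4 R.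
have := expR_mul1B_le1 (- (4 * e)); have := expR_ge0 (- (4 * e)).
move: (expR 1) (expR (- (4 * e))) E4 => X Y X4 Y0 H.
have YX : Y * (1 + 4 * e) <= 1 by lra.
have : (1 - e) * Y * (1 + 4 * e) <= 1 - e by rewrite -mulrA ler_piMr //; lra.
have : e * X <= e * 4 by rewrite ler_wpM2l // ltW.
have : 0 <= e * (e * (1 - 16 * e)) by rewrite !mulr_ge0 //; lra.
nra.
Qed.

Lemma shrink_factor_le (R : realType) (e : R) : e <= 20000^-1 -> 1 + 10000 * e <= 3 / 2.
Proof. lra. Qed.

(** [B], [zS] and [zC] stand for the price sum and the surpluses inside and outside the sample of a
    reference dual solution, [X] for the sample surplus at the learned prices. *)
Lemma sample_dual_bound (R : realType) (e B zS zC X : R) :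
  0 < e -> 0 <= zS -> 0 <= zC -> 0 <= B ->
  1 * zS - 4 * e * zC < 4 * (e * (B + (zS + zC))) -> X <= e * B + zS ->
  X <= 9 * (e * (B + (zS + zC))).
Proof.
move=> e0 zS0 zC0 B0 H HX.
have : 0 <= e * zS by rewrite mulr_ge0 // ltW.
have : 0 <= e * zC by rewrite mulr_ge0 // ltW.
have : 0 <= e * B by rewrite mulr_ge0 // ltW.
lra.
Qed.

(** With [D] the dual value at the learned prices and [Dh] that of the reference solution,
    [zS <= 18 e D] and so [T >= (1 - 28 e) D]; the remaining loss comes from shrinking the
    capacities. *)
Lemma value_guarantee (R : realType) (e T B zS zC opt Dh : R) :
  0 < e -> e <= 20000^-1 -> 0 <= zS -> 0 <= zC -> 0 <= B ->
  zC + (1 - 10 * e) * B <= T -> zS <= 9 * (e * Dh) -> Dh <= 2 * (B + (zS + zC)) ->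
  opt <= (1 + 10000 * e) * (B + (zS + zC)) -> (1 - 20000 * e) * opt <= T.
Proof.
move=> e0 e1 zS0 zC0 B0 HT HS HD Hopt; set D := B + (zS + zC) in HD Hopt.
have D0 : 0 <= D by rewrite /D; lra.
have H1 : e * Dh <= e * (2 * D) by rewrite ler_wpM2l // ltW.
have H2 : (1 - 28 * e) * D <= T.
  have : 0 <= e * zC by rewrite mulr_ge0 // ltW.
  have : 0 <= e * zS by rewrite mulr_ge0 // ltW.
  move: H1; rewrite /D; lra.
apply: le_trans H2; apply: (@le_trans _ _ ((1 - 20000 * e) * ((1 + 10000 * e) * D))).
  by rewrite ler_wpM2l //; lra.
have : 0 <= e * D by rewrite mulr_ge0 // ltW.
have : 0 <= e * (e * D) by rewrite !mulr_ge0 // ltW.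
lra.
Qed.

Lemma no_options_alternative (R : realType) (n m : nat) (Opt : finType)
  (P : packing R n m Opt) i c :
  max_options P = 0%N -> alternative P i c -> c = None.
Proof.
move=> q0; case: c => //= o oi.
have : (#|opts P i| <= 0)%N by rewrite -q0; exact: (leq_bigmax i).
by rewrite leqn0 cards_eq0 => /eqP o0; move: oi; rewrite o0 inE.
Qed.

Lemma no_options_OPT (R : realType) (n m : nat) (Opt : finType) (P : packing R n m Opt) :
  max_options P = 0%N -> OPT P <= 0.
Proof.
move=> q0; apply: bigmax_le => // x /andP[/forallP ax _].
by rewrite /total_value big1 // => i _; rewrite (no_options_alternative q0 (ax i)).
Qed.

(** * Failure probabilities of the algorithm *)

Section Online.
Variables (R : realType) (n m : nat) (Opt : finType) (P : packing R n m Opt) (eps : R).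
Variable prices : {set 'I_n} -> 'I_m -> R.
Let L : R := (m + 1)%:R * (ln n%:R + ln (max_options P)%:R).
Let k : R := 1 + 10000 * eps.
Let Q := shrink_caps k P.
Let alg (s : 'S_n) := training_based_alloc Q (sample eps s) (prices (sample eps s)).
Hypothesis P_valid : valid_packing P.
Hypotheses (eps_gt0 : 0 < eps) (eps_lt1 : eps < 1) (n_large : (1000 < n)%N).
Hypothesis value_small : forall i o, o \in opts P i -> value P i o / OPT P <= eps / L.
Hypothesis need_small : forall i o j, o \in opts P i -> need P i o j / cap P j <= eps ^+ 3 / L.
Hypothesis prices_opt :
  forall s : 'S_n, optimal_prices Q eps (sample eps s) (prices (sample eps s)).
Hypothesis prices_no_tie : forall (s : 'S_n) (i : 'I_n), i \notin sample eps s ->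
  no_tie Q (prices (sample eps s)) i.

Let d : R := k * (eps ^+ 3 / L).

Lemma shrink_gt0 : 0 < k. Proof. by rewrite addr_gt0 // mulr_gt0 // ltr0n. Qed.

Lemma ln_n_ge1 : 1 <= ln (n%:R : R).
Proof.
have n0 : 0 < n%:R :> R by rewrite ltr0n (ltn_trans _ n_large).
rewrite -ler_expR lnK ?posrE // (le_trans (expR1_le4 R)) // ler_nat; lia.
Qed.

(** If no agent has an option, this rests on the convention that the logarithm of 0 is 0. *)
Lemma ln_options_ge0 : 0 <= ln ((max_options P)%:R : R).
Proof. by case: max_options => [|q]; [rewrite ln0 | rewrite ln_ge0 // ler1n]. Qed.

Lemma log_factor_ge : (m + 1)%:R <= L.
Proof.
rewrite -[X in X <= _]mulr1 ler_wpM2l //.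
by have := ln_n_ge1; have := ln_options_ge0; lra.
Qed.

Lemma log_factor_gt0 : 0 < L.
Proof. by apply: lt_le_trans log_factor_ge; rewrite ltr0n addn1. Qed.

Lemma d_gt0 : 0 < d.
Proof. by rewrite mulr_gt0 ?shrink_gt0 // divr_gt0 ?log_factor_gt0 ?exprn_gt0. Qed.

Lemma log_factor_need_bound : L * d = k * eps ^+ 3.
Proof. by rewrite /d; field; rewrite gt_eqF ?log_factor_gt0. Qed.

Lemma capQ_gt0 j : 0 < cap Q j.
Proof. by case: P_valid => c0 _ _; rewrite divr_gt0 ?shrink_gt0. Qed.

Lemma norm_need_Q i o j : norm_need Q i o j = k * (need P i o j / cap P j).
Proof.
case: P_valid => c0 _ _; rewrite /norm_need /Q /shrink_caps /=.
by field; rewrite !gt_eqF ?shrink_gt0.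
Qed.

Lemma norm_need_bound i o j : o \in opts Q i -> 0 <= norm_need Q i o j <= d.
Proof.
case: P_valid => c0 _ a0 oi; rewrite norm_need_Q; apply/andP; split.
  by rewrite mulr_ge0 ?(ltW shrink_gt0) // divr_ge0 ?a0 // ltW.
by rewrite ler_wpM2l ?(ltW shrink_gt0) // need_small.
Qed.

Lemma load_best_bound (h : R) (F : {ffun 'I_n -> {set option Opt}}) j i : 0 <= h <= d ->
  (forall c, c \in F i -> alternative Q i c) -> 0 <= load Q h F j i <= d.
Proof. by apply: load_bound; [exact: d_gt0 | exact: norm_need_bound]. Qed.

Lemma infeasibleP s : ~~ feasible P (alg s) -> exists j,
  k < \sum_(i in ~: sample eps s) load Q 0 (best_alternatives Q (prices (sample eps s))) j i.
Proof.
rewrite negb_and => /orP[|].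
  by rewrite negb_forall => /existsP[i] /negP[]; exact: (alternative_alloc Q).
rewrite negb_forall => /existsP[j]; rewrite -ltNge => H; exists j.
rewrite -(alloc_need 0 j (@prices_no_tie s)).
move: H; rewrite -[usage P _ _]/(usage Q _ _) (usageE capQ_gt0).
case: P_valid => c0 _ _; rewrite /Q /= -/Q mulrAC ltr_pdivlMr ?shrink_gt0 //.
by rewrite ltr_pM2l.
Qed.

Lemma infeasible_prob : order_prob R (fun s => ~~ feasible P (alg s)) <= 13 / n%:R.
Proof.
rewrite /order_prob cardsT.
have N0 : 0 < #|'S_n|%:R :> R by rewrite ltr0n; apply/card_gt0P; exists 1%g.
have n0 : 0 < n%:R :> R by rewrite ltr0n (ltn_trans _ n_large).
rewrite ler_pdivrMr //.
set A := [set s | _].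
have A0 : A = finset.set0 -> #|A|%:R <= 13 / n%:R * #|'S_n|%:R :> R.
  by move=> ->; rewrite cards0 mulr_ge0 ?divr_ge0 ?ler0n.
have [q0|q0] := posnP (max_options P).
  apply: A0; apply/setP => s; rewrite !inE; apply/negbTE; rewrite negbK.
  apply/andP; split; first by apply/forallP => i; exact: (alternative_alloc Q).
  apply/forallP => j; rewrite /usage big1; first by case: P_valid => c0 _ _; exact: ltW.
  by move=> i _; rewrite (no_options_alternative q0 (alternative_alloc Q _ _ i)).
(* Either all agents together cannot exceed the capacity, or [1 / n < eps^3 / L], which controls the
   rounding of the sample size. *)
have [nd|nd] := leP (n%:R * (eps ^+ 3 / L)) 1.
  apply: A0; apply/setP => s; rewrite !inE; apply/negbTE/negP => /infeasibleP[j].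
  apply/negP; rewrite -leNgt; apply: (@le_trans _ _ (\sum_(i < n) d)).
    rewrite big_mkcond /=; apply: ler_sum => i _; case: ifP => _; last by rewrite ltW ?d_gt0.
    have : 0 <= load Q 0 (best_alternatives Q (prices (sample eps s))) j i <= d.
      apply: load_best_bound; first by rewrite lexx ltW ?d_gt0.
      by move=> c; exact: alternative_best.
    by case/andP.
  rewrite sumr_const card_ord -mulr_natl /d mulrCA -[X in _ <= X]mulr1.
  by rewrite ler_wpM2l // ltW ?shrink_gt0.
have nN : (0 < n)%N by rewrite (ltn_trans _ n_large).
have [F [szF altF bestF]] := best_alternatives_cover (Q := Q) nN q0.
(* An infeasible allocation overloads some resource; [0 < m] then gives [L >= 2]. *)
have m0 : A != finset.set0 -> (0 < m)%N.
  by move=> /set0Pn[s]; rewrite inE => /infeasibleP[[j jm] _]; exact: leq_ltn_trans jm.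
have [->|/m0 {m0 A0} m0] := eqVneq A finset.set0.
  by rewrite cards0 mulr_ge0 ?divr_ge0 ?ler0n.
pose p : R := (Num.truncn (eps * n%:R))%:R / n%:R.
have pn : p * n%:R = (Num.truncn (eps * n%:R))%:R by rewrite /p divfK // gt_eqF.
have en0 : 0 <= eps * n%:R by rewrite mulr_ge0 ?ltW.
have /andP[k1 k2] := truncn_itv en0.
have p_le : p <= eps by rewrite /p ler_pdivrMr.
have p_ge0 : 0 <= p by rewrite divr_ge0.
have p_ge : eps - n%:R^-1 <= p.
  by rewrite /p ler_pdivlMr // mulrBl mulVf ?gt_eqF // lerBlDr natr1 ltW.
have nV : n%:R^-1 <= eps ^+ 3 / 2.
  have e3 : 0 < eps ^+ 3 by rewrite exprn_gt0.
  have L2 : 2 <= L by apply: le_trans log_factor_ge; rewrite ler_nat addn1 ltnS.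
  rewrite -[X in X <= _]mul1r ler_pdivrMr // (le_trans (ltW nd)) // mulrC ler_wpM2r // ?(ltW n0) //.
  by rewrite ler_wpM2l ?(ltW e3) // lef_pV2 ?posrE ?log_factor_gt0.
have nV' : n%:R^-1 <= 1000^-1 :> R by rewrite lef_pV2 ?posrE // ler_nat ltnW.
have [eta [mu [eta0 mu0 mgf dev]]] : exists eta mu : R, [/\ 0 <= eta, 0 <= mu,
    (1 - p) * expR mu + p * expR (- eta) <= 1 &
    2 * eps ^+ 3 * (1 + 10000 * eps) <= mu * (1 + 10000 * eps) - eta * eps].
  apply: lower_tail_parameters => //.
  - by apply: le_trans p_ge; rewrite lerD2l lerN2.
  - by apply: le_trans p_ge; rewrite lerD2l lerN2.
pose E G j := [set s : 'S_n | 2 * L * d <= mu * (\sum_(i in ~: sample eps s) load Q 0 G j i)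
                           - eta * (\sum_(i in sample eps s) load Q 0 G j i)].
have : #|A|%:R <= (m * size F)%:R * (expR (- (2 * L)) * #|{perm 'I_n}|%:R) :> R.
  apply: (@union_bound _ _ _ F m A E).
    move=> s; rewrite inE => /infeasibleP[j Hj].
    exists (best_alternatives Q (prices (sample eps s))), j; split => //.
    (* The sample uses at most [eps] and the rest more than [k], so the deviation is at least
       [mu * k - eta * eps >= 2 k eps^3 = 2 L d]. *)
    have [H _] := optimal_prices_load d_gt0 norm_need_bound j (prices_opt s).
    rewrite inE -mulrA log_factor_need_bound (le_trans _ (lerB (ler_wpM2l mu0 (ltW Hj)) (ler_wpM2l eta0 H))) //.
    by rewrite mulrCA mulrC -/k in dev *; lra.
  move=> G j GF; apply: (@sample_lower_tail R n eps _ _ _ p) => //; rewrite ?ltW ?d_gt0 //.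
    exact: le_lt_trans eps_lt1.
  by move=> i; apply: load_best_bound => [|c]; [rewrite lexx ltW ?d_gt0 | exact: altF].
move=> /le_trans; apply; rewrite mulrA ler_wpM2r ?ler0n //.
apply: le_trans (union_bound_total R m n_large q0).
rewrite ler_wpM2r ?expR_ge0 // ler_nat leq_mul2l; apply/orP; right; exact: szF.
Qed.

Let dual_total beta := \sum_j beta j + \sum_i surplus Q beta i.

Lemma OPT_le_dual beta : (forall j, 0 <= beta j) -> OPT P <= k * dual_total beta.
Proof.
move=> b0; have k1 : 1 <= k by rewrite lerDl mulr_ge0 // ltW.
have D0 : 0 <= dual_total beta.
  by rewrite addr_ge0 // sumr_ge0 // => i _; exact: surplus_ge0.
apply: bigmax_le; first by rewrite mulr_ge0 // ltW ?shrink_gt0.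
move=> x /andP[/forallP ax /forallP ux].
apply: (weak_duality capQ_gt0) => // j.
by rewrite /Q /= mulrC divfK ?gt_eqF ?shrink_gt0 //; exact: ux.
Qed.

(** The reference solution does not depend on the arrival order, so it needs no union bound. An
    approximate minimiser suffices, and it exists because the infimum is positive by weak
    duality. *)
Lemma near_optimal_dual : 0 < OPT P -> exists2 beta, (forall j, 0 <= beta j) &
  forall beta', (forall j, 0 <= beta' j) -> dual_total beta <= 2 * dual_total beta'.
Proof.
move=> opt0.
pose D := [set x : R | exists2 beta, (forall j, 0 <= beta j) & x = dual_total beta]%classic.
have lbD x : D x -> OPT P / k <= x.
  by move=> [beta b0 ->]; rewrite ler_pdivrMr ?shrink_gt0 // mulrC; exact: OPT_le_dual.
have infD : has_inf D.
  split; first by exists (dual_total (fun=> 0)); exists (fun=> 0).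
  by exists (OPT P / k) => x /lbD.
have inf0 : 0 < inf D.
  apply: (@lt_le_trans _ _ (OPT P / k)); first by rewrite divr_gt0 ?shrink_gt0.
  by apply: lb_le_inf; [case: infD | move=> x /lbD].
have [x [beta b0 ->] H] := inf_adherent inf0 infD.
exists beta => // beta' b'0; have : inf D <= dual_total beta'.
  by apply: ge_inf; [case: infD | exists beta'].
move=> H'; by apply: (le_trans (ltW H)); rewrite mulr_natl mulr2n lerD.
Qed.

(** A surplus is at most one option value, hence at most [eps * OPT P / L], and [OPT P] is at most
    [k <= 2] times any dual value. *)
Lemma surplus_bound beta i : eps <= 20000^-1 -> (forall j, 0 <= beta j) -> 0 < OPT P ->
  0 <= surplus Q beta i <= 2 * (eps * dual_total beta) / L.
Proof.
move=> eps_small b0 opt0; rewrite surplus_ge0 /=.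
have D0 : 0 <= dual_total beta.
  by rewrite addr_ge0 ?sumr_ge0 // => i' _; exact: surplus_ge0.
have := alternative_best (best_option_best Q beta i); rewrite /surplus.
case: best_option => [o oi|_] /=; last by rewrite !mulr_ge0 ?invr_ge0 // ltW ?log_factor_gt0.
apply: (@le_trans _ _ (value P i o)).
  rewrite /gain lerBlDr lerDl sumr_ge0 // => j _; rewrite mulr_ge0 //.
  by case/andP: (norm_need_bound j oi).
have := value_small oi; rewrite ler_pdivrMr // => /le_trans; apply.
have eL : 0 <= eps / L by rewrite divr_ge0 // ltW ?log_factor_gt0.
apply: (le_trans (ler_wpM2l eL (OPT_le_dual b0))).
have -> : 2 * (eps * dual_total beta) / L = eps / L * (2 * dual_total beta) by ring.
rewrite ler_wpM2l // ler_wpM2r // (le_trans (shrink_factor_le eps_small)) //.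
by rewrite ler_pdivrMr // -natrM ler_nat.
Qed.

Lemma low_value_prob : eps <= 20000^-1 -> 0 < OPT P ->
  order_prob R (fun s => ~~ ((1 - 20000 * eps) * OPT P <= total_value P (alg s)))
    <= 14 / n%:R.
Proof.
move=> eps_small opt0.
have eps_small' : eps <= 100^-1.
  by rewrite (le_trans eps_small) // lef_pV2 ?posrE ?ltr0n // ler_nat.
rewrite /order_prob cardsT.
have N0 : 0 < #|'S_n|%:R :> R by rewrite ltr0n; apply/card_gt0P; exists 1%g.
have n0 : 0 < n%:R :> R by rewrite ltr0n (ltn_trans _ n_large).
have nN : (0 < n)%N by rewrite (ltn_trans _ n_large).
rewrite ler_pdivrMr //.
set A := [set s | _].
have q0 : (0 < max_options P)%N.
  by rewrite lt0n; apply: contraTneq opt0 => /no_options_OPT; rewrite leNgt.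
have [F [szF altF bestF]] := best_alternatives_cover (Q := Q) nN q0.
have [bh bh0 Hbh] := near_optimal_dual opt0.
set Dh := dual_total bh in Hbh.
have Dh0 : 0 < Dh.
  by have := OPT_le_dual bh0; move=> /(lt_le_trans opt0); rewrite pmulr_rgt0 ?shrink_gt0.
pose dz : R := 2 * (eps * Dh) / L.
have dz0 : 0 < dz by rewrite divr_gt0 ?log_factor_gt0 // mulr_gt0 // mulr_gt0.
(* The single bad event for the reference solution: its surplus is concentrated in the sample. *)
pose Z := [set s : 'S_n | 2 * L * dz <= 1 * (\sum_(i in sample eps s) surplus Q bh i)
                         - 4 * eps * (\sum_(i in ~: sample eps s) surplus Q bh i)].
pose mu := eps ^+ 2 * (1 + 6 * eps).
have mu0 : 0 <= mu by rewrite mulr_ge0 ?exprn_ge0 ?addr_ge0 ?mulr_ge0 // ltW.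
have dd : 0 <= d <= d by rewrite lexx ltW ?d_gt0.
pose E G j := [set s : 'S_n | 2 * L * d <= eps * (\sum_(i in sample eps s) load Q d G j i)
                           - mu * (\sum_(i in ~: sample eps s) load Q d G j i)].
have cardZ : #|Z|%:R <= n%:R^-1 * #|'S_n|%:R :> R.
  apply: (@le_trans _ _ (expR (- (2 * L)) * #|'S_n|%:R)).
    apply: sample_upper_tail; rewrite ?mulr_ge0 ?(ltW eps_gt0) ?(ltW eps_lt1) //.
      by move=> i; rewrite /dz /Dh; exact: surplus_bound.
    exact: dual_tail_mgf.
  rewrite ler_wpM2r ?ler0n // -[X in _ <= X^-1](lnK (x := n%:R)) ?posrE // -expRN ler_expR lerN2.
  have m1 : 1 <= (m + 1)%:R :> R by rewrite ler1n addn1.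
  rewrite mulrA; apply: (@le_trans _ _ (ln n%:R + ln (max_options P)%:R)).
    by rewrite lerDl ln_options_ge0.
  rewrite ler_peMl // ?addr_ge0 ?ln_options_ge0 ?(le_trans ler01 ln_n_ge1) //.
  by rewrite -natrM ler1n addn1.
have cardA : #|A :\: Z|%:R <= 13 / n%:R * #|'S_n|%:R :> R.
  have : #|A :\: Z|%:R <= (m * size F)%:R * (expR (- (2 * L)) * #|{perm 'I_n}|%:R) :> R.
    apply: (@union_bound _ _ _ F m _ E).
      move=> s; rewrite in_setD => /andP[sZ]; rewrite inE => sA.
      set S := sample eps s in sZ *; set beta := prices S.
      (* If no resource has a bad event, the value guarantee holds and contradicts [sA]. *)
      have [/existsP[j sj]|nE] := boolP [exists j, s \in E (best_alternatives Q beta) j].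
        by exists (best_alternatives Q beta), j.
      case/negP: sA.
      have [b0 bopt] := optimal_prices_surplus (prices_opt s).
      have big_S (f : 'I_n -> R) : \sum_i f i = \sum_(i in S) f i + \sum_(i in ~: S) f i.
        by rewrite (bigID (mem S)) /=; congr (_ + _); apply: eq_bigl => i; rewrite inE.
      apply: (@value_guarantee R eps _ (\sum_j beta j) (\sum_(i in S) surplus Q beta i)
        (\sum_(i in ~: S) surplus Q beta i) _ Dh) => //.
      - by apply: sumr_ge0 => i _; exact: surplus_ge0.
      - by apply: sumr_ge0 => i _; exact: surplus_ge0.
      - exact: sumr_ge0.
      - rewrite -[total_value P _]/(total_value Q _) (alloc_value d (@prices_no_tie s)) lerD2l.
        rewrite mulr_sumr; apply: ler_sum => j _; rewrite mulrC -/S -/beta.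
        have [->|bj] := eqVneq (beta j) 0; first by rewrite !mul0r.
        have bj0 : 0 < beta j by rewrite lt_neqAle eq_sym bj b0.
        rewrite ler_wpM2l //.
        have [_ /(_ bj0) HS] := optimal_prices_load d_gt0 norm_need_bound j (prices_opt s).
        apply: (upper_tail_contra eps_gt0 eps_small' _ HS (k := k)).
          exact: shrink_factor_le.
        move: nE; rewrite negb_exists => /forallP/(_ j).
        by rewrite inE -ltNge -mulrA log_factor_need_bound.
      - rewrite /Dh /dual_total big_S; apply: sample_dual_bound => //.
        + by apply: sumr_ge0 => i _; exact: surplus_ge0.
        + by apply: sumr_ge0 => i _; exact: surplus_ge0.
        + exact: sumr_ge0.
        + move: sZ; rewrite inE -ltNge -/S => /lt_le_trans; apply.
          rewrite -big_S -/(dual_total bh) -/Dh /dz le_eqVlt; apply/orP; left; apply/eqP.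
          by field; rewrite gt_eqF ?log_factor_gt0.
        (* The learned prices do at least as well on the sample as the reference prices; their own
           price term is dropped. *)
        + have := bopt _ bh0; rewrite /dual_objective -!mulr_sumr; apply: le_trans.
          by rewrite lerDr mulr_ge0 ?sumr_ge0 // ltW.
      - rewrite -big_S; exact: Hbh.
      - rewrite -big_S; exact: OPT_le_dual.
    move=> G j GF; apply: sample_upper_tail; rewrite ?d_gt0 ?(ltW eps_gt0) ?(ltW eps_lt1) //.
      by move=> i; apply: load_best_bound => // c; exact: altF.
    exact: upper_tail_mgf.
  move=> /le_trans; apply; rewrite mulrA ler_wpM2r ?ler0n //.
  apply: le_trans (union_bound_total R m n_large q0).
  rewrite ler_wpM2r ?expR_ge0 // ler_nat leq_mul2l; apply/orP; right; exact: szF.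
apply: (@le_trans _ _ (#|A :\: Z|%:R + #|Z|%:R)).
  by rewrite -natrD ler_nat -(cardsID Z A) addnC leq_add2l subset_leq_card // subsetIr.
by apply: le_trans (lerD cardA cardZ) _; rewrite -mulrDl ler_wpM2r ?ler0n //
  -[X in _ + X]mul1r -mulrDl ler_wpM2r ?invr_ge0 ?ler0n // natr1.
Qed.

End Online.

(** * Combination of the two estimates and degenerate cases *)

Lemma order_prob_andb_ge (R : realType) (n : nat) (E1 E2 : pred 'S_n) :
  1 - (order_prob R (fun s => ~~ E1 s) + order_prob R (fun s => ~~ E2 s))
    <= order_prob R (fun s => E1 s && E2 s).
Proof.
have N0 : 0 < #|[set: 'S_n]|%:R :> R.
  by rewrite cardsT ltr0n; apply/card_gt0P; exists 1%g.
rewrite lerBlDr -!mulrDl ler_pdivlMr // mul1r -!natrD ler_nat.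
apply: (@leq_trans #|[set s | E1 s && E2 s] :|: ([set s | ~~ E1 s] :|: [set s | ~~ E2 s])|).
  apply/subset_leq_card/subsetP => s _; rewrite !inE.
  by case: (E1 s); case: (E2 s).
by rewrite (leq_trans (leq_card_setU _ _)) // leq_add2l leq_card_setU.
Qed.

Lemma OPT_ge0 (R : realType) (n m : nat) (Opt : finType) (P : packing R n m Opt) :
  0 <= OPT P.
Proof. exact: bigmax_ge_id. Qed.

Lemma alloc_value_ge0 (R : realType) (n m : nat) (Opt : finType) (P : packing R n m Opt)
  S beta : valid_packing P -> 0 <= total_value P (training_based_alloc P S beta).
Proof.
move=> [_ v0 _]; apply: sumr_ge0 => i _.
have := alternative_alloc P S beta i; case: (training_based_alloc P S beta i) => //= o.
exact: v0.
Qed.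

Theorem theorem1 (R : realType) :
  exists Ccap Cval Cprob : R, [/\ 0 < Ccap, 0 < Cval, 0 < Cprob &
  forall (n m : nat) (Opt : finType) (P : packing R n m Opt) (eps : R)
    (prices : {set 'I_n} -> 'I_m -> R),
  valid_packing P ->
  0 < eps -> eps < 1 ->
  (forall (i : 'I_n) (o : Opt), o \in opts P i ->
     value P i o / OPT P
     <= eps / ((m + 1)%:R * (ln n%:R + ln (max_options P)%:R))) ->
  (forall (i : 'I_n) (o : Opt) (j : 'I_m), o \in opts P i ->
     need P i o j / cap P j
     <= eps ^+ 3 / ((m + 1)%:R * (ln n%:R + ln (max_options P)%:R))) ->
  let P' := shrink_caps (1 + Ccap * eps) P in
  (forall s : 'S_n,
     optimal_prices P' eps (sample eps s) (prices (sample eps s))) ->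
  (forall (s : 'S_n) (i : 'I_n), i \notin sample eps s ->
     no_tie P' (prices (sample eps s)) i) ->
  let alg (s : 'S_n) :=
    training_based_alloc P' (sample eps s) (prices (sample eps s)) in
  1 - Cprob / n%:R
  <= order_prob R (fun s : 'S_n =>
       feasible P (alg s) && ((1 - Cval * eps) * OPT P <= total_value P (alg s)))].
Proof.
(* The probability bound is trivial for [n <= 1000] and the value bound for [eps >= 1 / 20000]. *)
exists 10000, 20000, 1000; split; rewrite ?ltr0n // => n m Opt P eps prices.
move=> P_valid eps0 eps1 Hv Ha P' Hopt Htie.
pose alg (s : 'S_n) :=
  training_based_alloc P' (sample eps s) (prices (sample eps s)).
change (1 - 1000 / n%:R <= order_prob R (fun s : 'S_n =>
  feasible P (alg s) && ((1 - 20000 * eps) * OPT P <= total_value P (alg s)))).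
have prob_ge0 (E : pred 'S_n) : 0 <= order_prob R E by rewrite divr_ge0.
(* For [n = 0] the quotient by [n] is 0, so the event must have probability exactly 1. *)
have [n0|n0] := posnP n.
  have E : [set s | feasible P (alg s) && ((1 - 20000 * eps) * OPT P <= total_value P (alg s))]
      = [set: 'S_n].
    subst n; apply/setP => s; rewrite !inE.
    have q0 : max_options P = 0%N by rewrite /max_options big_ord0.
    have -> : OPT P = 0 by apply/eqP; rewrite eq_le OPT_ge0 no_options_OPT.
    rewrite mulr0 /total_value big_ord0 lexx andbT.
    apply/andP; split; apply/forallP; first by case.
    by move=> j; rewrite /usage big_ord0; case: P_valid => c0 _ _; exact: ltW.
  rewrite /order_prob E divff; first by rewrite n0 invr0 mulr0 subr0.
  by rewrite cardsT pnatr_eq0 -lt0n; apply/card_gt0P; exists 1%g.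
have nR : 0 < n%:R :> R by rewrite ltr0n.
have [n_small|n_large] := leqP n 1000.
  apply: le_trans (prob_ge0 _).
  by rewrite subr_le0 ler_pdivlMr // mul1r ler_nat.
apply: le_trans (order_prob_andb_ge _ _ _); rewrite lerD2l lerN2.
apply: (@le_trans _ _ (13 / n%:R + 14 / n%:R)); last first.
  by rewrite -mulrDl ler_wpM2r ?invr_ge0 // -natrD ler_nat.
apply: lerD; first exact: infeasible_prob.
have [/andP[eps_small opt0]|triv] := boolP ((eps <= 20000^-1) && (0 < OPT P)).
  exact: low_value_prob.
(* Here the required value is at most 0, so no order fails. *)
rewrite /order_prob (_ : [set s | _] = finset.set0) ?cards0 ?mul0r ?divr_ge0 //.
apply/setP => s; rewrite !inE; apply/negbTE; rewrite negbK.
apply: le_trans (alloc_value_ge0 (P := P') _ _ _); last first.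
  case: P_valid => c0 v0 a0; split => // j; rewrite divr_gt0 //.
  by rewrite addr_gt0 // mulr_gt0 // ltr0n.
move: triv; rewrite negb_and -ltNge -leNgt => /orP[eps_big|opt_le0].
  rewrite mulr_le0_ge0 ?OPT_ge0 // subr_le0.
  by rewrite -ler_pdivrMl ?ltr0n // mulr1 ltW.
have -> : OPT P = 0 by apply/eqP; rewrite eq_le OPT_ge0 opt_le0.
by rewrite mulr0.
Qed.
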